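(* Let $n$ be a nonzero integer, let $M=e^{i\alpha/2}$ with $\alpha$ real, let $x\in\mathbb{C}$, and set $$\rho(s)=S=\begin{pmatrix}M&1\\0&M^{-1}\end{pmatrix},\qquad \rho(t)=T=\begin{pmatrix}M&0\\2-M^2-M^{-2}-x&M^{-1}\end{pmatrix}.$$ Then $\rho$ is a representation of $$\pi_1(X_{2n})=\langle s,t\mid swt^{-1}w^{-1}=1\rangle,\qquad w=(ts^{-1}ts^{-1}t^{-1}st^{-1}s)^n,$$ into $SL(2,\mathbb{C})$ if and only if $x$ is a root of the Riley-Mednykh polynomial $P_{2n}=P_{2n}(x,M)$, which is given recursively by $$P_{2n}=\begin{cases} Q\,P_{2(n-1)}-M^{12}P_{2(n-2)} & \text{if } n>1,\\ Q\,P_{2(n+1)}-M^{12}P_{2(n+2)} & \text{if } n<-1,\end{cases}$$ with initial conditions $$P_{-2}=-M^4x^3-(2M^6-M^4+2M^2)x^2-(M^8-M^6+2M^4-M^2+1)x+M^4,$$ $$P_0=M^{-2}\ \text{ for } n<0,\qquad P_0=1\ \text{ for } n>0,$$ $$\begin{aligned}P_2={}&M^6x^4+(3M^8-M^6+3M^4)x^3+(3M^{10}-2M^8+5M^6-2M^4+3M^2)x^2\\&+(M^{12}-M^{10}+2M^8-2M^6+2M^4-M^2+1)x+M^6,\end{aligned}$$ and $$\begin{aligned}Q={}&M^6x^4+(3M^8-2M^6+3M^4)x^3+(3M^{10}-4M^8+6M^6-4M^4+3M^2)x^2\\&+(M^{12}-2M^{10}+3M^8-4M^6+3M^4-2M^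2+1)x+2M^6.\end{aligned}$$
   Context: $X_{2n}$ is the complement in $S^3$ of the two-bridge knot $T_{2n}$ with Conway's notation $C(2n,4)$ (slope $\frac{6n+1}{8n+1}$), whose fundamental group has the presentation given in the claim. ''$\rho$ is a representation'' means that the assignment $s\mapsto S$, $t\mapsto T$ extends to a homomorphism $\pi_1(X_{2n})\to SL(2,\mathbb{C})$, i.e. that $SWT^{-1}W^{-1}=I$ where $W=(TS^{-1}TS^{-1}T^{-1}ST^{-1}S)^n$. *)

(* Defs.v *)
From HB Require Import structures.
From mathcomp Require Import all_boot all_order all_algebra.
From mathcomp Require Import generic_quotient monoid.
From mathcomp Require Import boolp reals trigo.
From mathcomp Require Import complex.

Set Implicit Arguments.
Unset Strict Implicit.
Unset Printing Implicit Defensive.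

Import GRing.Theory Num.Theory.

Section PresentedGroup.
Variable X : choiceType.

(* A letter (a, false) stands for the generator a, and (a, true) for a^-1. *)
Definition word := seq (X * bool).
HB.instance Definition _ := Choice.on word.

Definition winv (w : word) : word := rev [seq (a.1, ~~ a.2) | a <- w].

Definition wpow (w : word) (n : int) : word :=
  match n with
  | Posz k => flatten (nseq k w)
  | Negz k => flatten (nseq k.+1 (winv w))
  end.

(* Two words are related iff they are equal in the group < X | rels >. *)
Inductive word_eq (rels : word -> Prop) : word -> word -> Prop :=
| word_eq_refl u : word_eq rels u u
| word_eq_sym u v : word_eq rels u v -> word_eq rels v u
| word_eq_trans v u w : word_eq rels u v -> word_eq rels v w -> word_eq rels u w
| word_eq_cancel u v a b :
    word_eq rels (u ++ [:: (a, b); (a, ~~ b)] ++ v) (u ++ v)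
| word_eq_rel u v r : rels r -> word_eq rels (u ++ r ++ v) (u ++ v).

Lemma word_eq_cat rels u u' v v' :
  word_eq rels u u' -> word_eq rels v v' -> word_eq rels (u ++ v) (u' ++ v').
Proof.
move=> hu hv; apply: (@word_eq_trans _ (u' ++ v)).
- elim: hu v {v' hv} => [w|w w' _ IH|w2 w1 w3 _ IH1 _ IH2|w w' a b|w w' r hr] v.
  + exact: word_eq_refl.
  + exact: word_eq_sym.
  + exact: word_eq_trans (IH1 v) (IH2 v).
  + by rewrite -!catA; apply: word_eq_cancel.
  + by rewrite -!catA; apply: word_eq_rel.
- elim: hv u' {u hu} => [w|w w' _ IH|w2 w1 w3 _ IH1 _ IH2|w w' a b|w w' r hr] u.
  + exact: word_eq_refl.
  + exact: word_eq_sym.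
  + exact: word_eq_trans (IH1 u) (IH2 u).
  + by rewrite !(catA u); apply: word_eq_cancel.
  + by rewrite !(catA u); apply: word_eq_rel.
Qed.

Lemma winvK : involutive winv.
Proof.
move=> w; rewrite /winv map_rev revK -map_comp -[RHS]map_id.
by apply: eq_map => -[a b] /=; rewrite negbK.
Qed.

Lemma winv_cat u v : winv (u ++ v) = winv v ++ winv u.
Proof. by rewrite /winv map_cat rev_cat. Qed.

Lemma word_eq_mulV rels w : word_eq rels (w ++ winv w) [::].
Proof.
elim: w => [|[a b] w IH]; first exact: word_eq_refl.
rewrite -cat1s winv_cat /= -cat_cons -cat1s -!catA (catA w).
apply: (@word_eq_trans _ ([:: (a, b)] ++ [::] ++ [:: (a, ~~ b)])).
  apply: word_eq_cat (word_eq_refl _ _) _.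
  exact: word_eq_cat IH (word_eq_refl _ _).
exact: (@word_eq_cancel _ [::] [::]).
Qed.

Lemma word_eq_Vmul rels w : word_eq rels (winv w ++ w) [::].
Proof. by rewrite -{2}(winvK w); apply: word_eq_mulV. Qed.

Lemma word_eq_inv rels u v :
  word_eq rels u v -> word_eq rels (winv u) (winv v).
Proof.
move=> huv; apply: (@word_eq_trans _ (winv u ++ (v ++ winv v))).
  rewrite -{1}(cats0 (winv u)); apply: word_eq_cat (word_eq_refl _ _) _.
  exact/word_eq_sym/word_eq_mulV.
rewrite catA -{2}(cat0s (winv v)); apply: word_eq_cat (word_eq_refl _ _).
apply: word_eq_trans (word_eq_Vmul _ u).
by apply: word_eq_cat (word_eq_refl _ _) _; apply: word_eq_sym.
Qed.

Definition word_eqb rels : rel word := fun u v => `[< word_eq rels u v >].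

Lemma word_eqb_refl rels : reflexive (word_eqb rels).
Proof. by move=> u; apply/asboolP/word_eq_refl. Qed.
Lemma word_eqb_sym rels : symmetric (word_eqb rels).
Proof. by move=> u v; apply/asboolP/asboolP => /word_eq_sym. Qed.
Lemma word_eqb_trans rels : transitive (word_eqb rels).
Proof.
move=> v u w /asboolP huv /asboolP hvw.
exact/asboolP/(word_eq_trans huv hvw).
Qed.

Canonical word_eqb_equiv rels :=
  EquivRel (word_eqb rels) (@word_eqb_refl rels) (@word_eqb_sym rels)
    (@word_eqb_trans rels).

Local Open Scope quotient_scope.

(* The group < X | rels >. *)
Definition presented (rels : word -> Prop) := {eq_quot (word_eqb rels)}.

Section Instances.
Variable rels : word -> Prop.
Local Notation G := (presented rels).

HB.instance Definition _ := Choice.on G.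

Definition presented_class (w : word) : G := \pi w.

Lemma presented_classP u v :
  presented_class u = presented_class v <-> word_eq rels u v.
Proof.
by split=> [/eqmodP/asboolP //|h]; apply/eqmodP/asboolP.
Qed.

Definition presented_mul (x y : G) : G := presented_class (repr x ++ repr y).
Definition presented_inv (x : G) : G := presented_class (winv (repr x)).

Lemma presented_reprK (x : G) : presented_class (repr x) = x.
Proof. exact: reprK. Qed.

Lemma repr_presented u : word_eq rels (repr (presented_class u)) u.
Proof. by apply/presented_classP; rewrite presented_reprK. Qed.

Lemma presented_mulE u v :
  presented_mul (presented_class u) (presented_class v)
  = presented_class (u ++ v).
Proof. by apply/presented_classP/word_eq_cat; apply: repr_presented. Qed.

Lemma presented_invE u :
  presented_inv (presented_class u) = presented_class (winv u).
Proof. exact/presented_classP/word_eq_inv/repr_presented. Qed.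

Lemma presented_mulA : associative presented_mul.
Proof.
move=> x y z; rewrite -(presented_reprK x) -(presented_reprK y).
by rewrite -(presented_reprK z) !presented_mulE catA.
Qed.

Lemma presented_mul1 : left_id (presented_class [::]) presented_mul.
Proof. by move=> x; rewrite -(presented_reprK x) presented_mulE. Qed.

Lemma presented_mulr1 : right_id (presented_class [::]) presented_mul.
Proof. by move=> x; rewrite -(presented_reprK x) presented_mulE cats0. Qed.

Lemma presented_mulV :
  left_inverse (presented_class [::]) presented_inv presented_mul.
Proof.
move=> x; rewrite -(presented_reprK x) presented_invE presented_mulE.
exact/presented_classP/word_eq_Vmul.
Qed.

Lemma presented_mulrV :
  right_inverse (presented_class [::]) presented_inv presented_mul.
Proof.
move=> x; rewrite -(presented_reprK x) presented_invE presented_mulE.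
exact/presented_classP/word_eq_mulV.
Qed.

HB.instance Definition _ := isGroup.Build G presented_mulA presented_mul1
  presented_mulr1 presented_mulV presented_mulrV.

Definition presented_gen (a : X) : G := presented_class [:: (a, false)].

End Instances.
End PresentedGroup.

Section SpecialLinear.
Variables (n : nat) (K : comUnitRingType).
Local Open Scope ring_scope.

Definition SL := {A : 'M[K]_n | \det A == 1}.
HB.instance Definition _ := SubChoice.on SL.

Lemma SL_one_subproof : \det (1%:M : 'M[K]_n) == 1.
Proof. by rewrite det1. Qed.
Lemma SL_mul_subproof (A B : SL) : \det (val A *m val B) == 1.
Proof. by rewrite det_mulmx (eqP (valP A)) (eqP (valP B)) mulr1. Qed.
Lemma SL_inv_subproof (A : SL) : \det (invmx (val A)) == 1.
Proof. by rewrite det_inv (eqP (valP A)) invr1. Qed.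

Definition SL_one : SL := Sub 1%:M SL_one_subproof.
Definition SL_mul (A B : SL) : SL := Sub (val A *m val B) (SL_mul_subproof A B).
Definition SL_inv (A : SL) : SL := Sub (invmx (val A)) (SL_inv_subproof A).

Lemma SL_unit (A : SL) : val A \in unitmx.
Proof. by rewrite unitmxE (eqP (valP A)) unitr1. Qed.

Lemma SL_mulA : associative SL_mul.
Proof. by move=> A B D; apply: val_inj; rewrite /= mulmxA. Qed.
Lemma SL_mul1 : left_id SL_one SL_mul.
Proof. by move=> A; apply: val_inj; rewrite /= mul1mx. Qed.
Lemma SL_mulr1 : right_id SL_one SL_mul.
Proof. by move=> A; apply: val_inj; rewrite /= mulmx1. Qed.
Lemma SL_mulV : left_inverse SL_one SL_inv SL_mul.
Proof. by move=> A; apply: val_inj; rewrite /= mulVmx ?SL_unit. Qed.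
Lemma SL_mulrV : right_inverse SL_one SL_inv SL_mul.
Proof. by move=> A; apply: val_inj; rewrite /= mulmxV ?SL_unit. Qed.

HB.instance Definition _ := isGroup.Build SL SL_mulA SL_mul1 SL_mulr1
  SL_mulV SL_mulrV.

End SpecialLinear.

Inductive knot_gen := gen_s | gen_t.

Definition bool_of_knot_gen g := if g is gen_s then true else false.
Definition knot_gen_of_bool (b : bool) := if b then gen_s else gen_t.
Lemma bool_of_knot_genK : cancel bool_of_knot_gen knot_gen_of_bool.
Proof. by case. Qed.
HB.instance Definition _ := Choice.copy knot_gen (can_type bool_of_knot_genK).

Section KnotGroup.
Let s : knot_gen * bool := (gen_s, false).
Let s' : knot_gen * bool := (gen_s, true).
Let t : knot_gen * bool := (gen_t, false).
Let t' : knot_gen * bool := (gen_t, true).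

Definition knot_w (n : int) : word knot_gen :=
  wpow [:: t; s'; t; s'; t'; s; t'; s] n.

Definition knot_relator (n : int) : word knot_gen :=
  [:: s] ++ knot_w n ++ [:: t'] ++ winv (knot_w n).

(* The group of the two-bridge knot C(2n,4). *)
Definition pi1X (n : int) : groupType :=
  presented (fun r => r = knot_relator n).

Definition pi1X_s (n : int) : pi1X n := presented_gen _ gen_s.
Definition pi1X_t (n : int) : pi1X n := presented_gen _ gen_t.

End KnotGroup.

Local Open Scope ring_scope.
Local Open Scope complex_scope.

(* exp (i theta), by Euler's formula *)
Definition expi (R : realType) (theta : R) : R[i] := cos theta +i* sin theta.

Definition mx2 (K : nzRingType) (a b c d : K) : 'M[K]_2 :=
  \matrix_(i < 2, j < 2)
    if i == 0 then (if j == 0 then a else b) else (if j == 0 then c else d).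

Section Matrices.
Variable K : fieldType.

Definition matS (M : K) : 'M[K]_2 :=
  mx2 M 1
      0 M^-1.

Definition matT (M x : K) : 'M[K]_2 :=
  mx2 M                               0
      (2 - M ^+ 2 - M ^- 2 - x) M^-1.

(* All the polynomials below are in the indeterminate x, M being a parameter. *)

Definition polyPm2 (M : K) : {poly K} :=
  - (M ^+ 4 *: 'X^3)
  - (2 * M ^+ 6 - M ^+ 4 + 2 * M ^+ 2) *: 'X^2
  - (M ^+ 8 - M ^+ 6 + 2 * M ^+ 4 - M ^+ 2 + 1) *: 'X
  + (M ^+ 4)%:P.

Definition polyP2 (M : K) : {poly K} :=
  M ^+ 6 *: 'X^4
  + (3 * M ^+ 8 - M ^+ 6 + 3 * M ^+ 4) *: 'X^3
  + (3 * M ^+ 10 - 2 * M ^+ 8 + 5 * M ^+ 6 - 2 * M ^+ 4 + 3 * M ^+ 2) *: 'X^2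
  + (M ^+ 12 - M ^+ 10 + 2 * M ^+ 8 - 2 * M ^+ 6 + 2 * M ^+ 4 - M ^+ 2 + 1)
      *: 'X
  + (M ^+ 6)%:P.

Definition polyQ (M : K) : {poly K} :=
  M ^+ 6 *: 'X^4
  + (3 * M ^+ 8 - 2 * M ^+ 6 + 3 * M ^+ 4) *: 'X^3
  + (3 * M ^+ 10 - 4 * M ^+ 8 + 6 * M ^+ 6 - 4 * M ^+ 4 + 3 * M ^+ 2) *: 'X^2
  + (M ^+ 12 - 2 * M ^+ 10 + 3 * M ^+ 8 - 4 * M ^+ 6 + 3 * M ^+ 4
     - 2 * M ^+ 2 + 1) *: 'X
  + (2 * M ^+ 6)%:P.

(* k |-> P_{2k} *)
Fixpoint riley_pos (M : K) (k : nat) : {poly K} :=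
  match k with
  | 0 => 1
  | 1 => polyP2 M
  | (k1.+1 as k2).+1 =>
      polyQ M * riley_pos M k2 - (M ^+ 12) *: riley_pos M k1
  end.

(* k |-> P_{-2k} *)
Fixpoint riley_neg (M : K) (k : nat) : {poly K} :=
  match k with
  | 0 => (M ^- 2)%:P
  | 1 => polyPm2 M
  | (k1.+1 as k2).+1 =>
      polyQ M * riley_neg M k2 - (M ^+ 12) *: riley_neg M k1
  end.

(* The Riley-Mednykh polynomial P_{2n}; only meaningful for n != 0, since P_0
   depends on the sign of the n from which the recursion started. *)
Definition riley_mednykh (M : K) (n : int) : {poly K} :=
  match n with
  | Posz k => riley_pos M k
  | Negz k => riley_neg M k.+1
  end.

End Matrices.

(* Main.v *)
(* By von Dyck, the representation exists iff S W = W T, where W = U^n and U is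
   the value of t s^-1 t s^-1 t^-1 s t^-1 s. That word is invariant under
   reversal combined with s <-> t, which forces U_21 = T_21 U_12; by
   Cayley-Hamilton every power of U inherits this linear relation. Given it,
   S W = W T collapses to the single equation (Riley)
   W_22 + (M - M^-1) W_12 = 0. Again by Cayley-Hamilton, the left-hand side
   satisfies f_(n+1) = tr(U) f_n - f_(n-1); since M^6 tr(U) = Q, the multiples
   M^(6n) f_n for n > 0, and M^(6|n| - 2) f_n for n < 0, satisfy the recurrence
   of P_2n. *)
Require Import Defs.
From HB Require Import structures.
From mathcomp Require Import all_boot all_order all_algebra.
From mathcomp Require Import monoid reals trigo complex ring.

Set Implicit Arguments.
Unset Strict Implicit.
Unset Printing Implicit Defensive.

Import GRing.Theory Num.Theory.
Local Open Scope ring_scope.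
Local Open Scope complex_scope.

(** * Evaluation of words in a group *)

Section WordEvaluation.
Variables (X : choiceType) (G : groupType) (f : X -> G).
Local Open Scope group_scope.

Definition leval (a : X * bool) : G := if a.2 then (f a.1)^-1 else f a.1.

Fixpoint weval (w : word X) : G :=
  if w is a :: w' then leval a * weval w' else 1.

Lemma weval_cat u v : weval (u ++ v) = weval u * weval v.
Proof. by elim: u => [|a u IH] /=; rewrite ?mul1g // IH mulgA. Qed.

Lemma leval_neg (a : X) b : leval (a, ~~ b) = (leval (a, b))^-1.
Proof. by case: b; rewrite /leval /= ?invgK. Qed.

Lemma weval_winv w : weval (winv w) = (weval w)^-1.
Proof.
elim: w => [|[a b] w IH]; first by rewrite /winv /= invg1.
by rewrite -cat1s winv_cat !weval_cat IH invgM /= !mulg1 leval_neg.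
Qed.

Lemma weval_wpow w n :
  weval (wpow w n) =
    match n with Posz k => weval w ^+ k | Negz k => (weval w)^-1 ^+ k.+1 end.
Proof.
have eval_nseq k v : weval (flatten (nseq k v)) = weval v ^+ k.
  by elim: k => [|k IH] //=; rewrite weval_cat IH expgS.
by case: n => k; rewrite /wpow eval_nseq // weval_winv.
Qed.

(** Each elementary move preserves the value: a cancelling pair contributes g g^-1 and a relator
    contributes 1. Evaluation therefore descends to the presented group. *)
Lemma weval_word_eq (rels : word X -> Prop) u v :
  (forall r, rels r -> weval r = 1) -> word_eq rels u v -> weval u = weval v.
Proof.
move=> fr; elim=> {u v} // [v u w _ -> _ -> //|u v a b|u v r /fr r1].
- rewrite !weval_cat /= leval_neg; congr (_ * _).
  by rewrite mulg1 mulgV mul1g.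
- by rewrite !weval_cat r1 mul1g.
Qed.

End WordEvaluation.

(** * Von Dyck's theorem for presented groups *)

Section Presented.
Variables (X : choiceType) (G : groupType) (rels : word X -> Prop).
Local Open Scope group_scope.

Lemma multiplicative1 (H : groupType) (rho : {multiplicative H -> G}) :
  rho 1 = 1.
Proof. by apply: (@mulgI G (rho 1)); rewrite -gmulfM !mulg1. Qed.

Lemma multiplicativeV (H : groupType) (rho : {multiplicative H -> G}) x :
  rho x^-1 = (rho x)^-1.
Proof.
by apply: (@mulgI G (rho x)); rewrite -gmulfM !mulgV multiplicative1.
Qed.

Lemma presented_class_cons (a : X * bool) w :
  presented_class rels (a :: w) =
    presented_class rels [:: a] * presented_class rels w.
Proof. by rewrite -cat1s -presented_mulE. Qed.

(** A homomorphism is forced on words by its values on generators; this serves the necessity half of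
    von Dyck's theorem. *)
Lemma multiplicative_weval (rho : {multiplicative presented rels -> G}) w :
  rho (presented_class rels w) = weval (fun a => rho (presented_gen rels a)) w.
Proof.
elim: w => [|[a b] w IH] /=; first exact: multiplicative1.
rewrite presented_class_cons gmulfM IH; congr (_ * _); case: b => //=.
have gV : (presented_gen rels a)^-1 = presented_class rels [:: (a, true)].
  exact: presented_invE.
by rewrite -gV multiplicativeV.
Qed.

Lemma presented_hom_existsP (f : X -> G) :
  (exists rho : {multiplicative presented rels -> G},
     forall a, rho (presented_gen rels a) = f a)
  <-> (forall r, rels r -> weval f r = 1).
Proof.
split=> [[rho rhoE] r rr|fr].
  have ->: weval f r = rho (presented_class rels r).
    rewrite multiplicative_weval.
    by elim: r {rr} => //= a w ->; rewrite /leval rhoE.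
  rewrite -(multiplicative1 rho); congr (rho _); apply/presented_classP.
  by rewrite -[r]cats0; apply: (@word_eq_rel _ rels [::] [::]).
(* Evaluate the chosen representative of a class; since relators evaluate to 1, any other word of
   the class gives the same value. *)
pose g (x : presented rels) := weval f (repr x).
have gE w : g (presented_class rels w) = weval f w.
  exact/(weval_word_eq fr)/repr_presented.
have gM : {morph g : x y / x * y}.
  by move=> x y; rewrite [x * y]/(presented_mul x y) gE weval_cat.
pose gm := isMultiplicative.Build _ _ g gM.
pose rho : {multiplicative presented rels -> G} := HB.pack g gm.
by exists rho => a; rewrite -[LHS]/(g _) gE /= mulg1.
Qed.

End Presented.

(** * Two-by-two matrices and Cayley-Hamilton *)

Section TwoByTwo.
Variable K : fieldType.
Implicit Types (a b c d M x : K) (A W : 'M[K]_2).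

Lemma mx2_eta A : A = mx2 (A 0 0) (A 0 1) (A 1 0) (A 1 1).
Proof.
by apply/matrixP => -[[|[|//]] hi] -[[|[|//]] hj]; rewrite mxE /=;
  congr (A _ _); apply: val_inj.
Qed.

Lemma mx2E a b c d :
  ((mx2 a b c d 0 0 = a) * (mx2 a b c d 0 1 = b) *
   (mx2 a b c d 1 0 = c) * (mx2 a b c d 1 1 = d))%type.
Proof. by rewrite !mxE. Qed.

Lemma mx2_mul a b c d a' b' c' d' :
  mx2 a b c d *m mx2 a' b' c' d' =
  mx2 (a * a' + b * c') (a * b' + b * d') (c * a' + d * c') (c * b' + d * d').
Proof.
by apply/matrixP => -[[|[|//]] hi] -[[|[|//]] hj];
  rewrite !mxE !big_ord_recl big_ord0 !mxE /= addr0.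
Qed.

Lemma det_mx2 a b c d : \det (mx2 a b c d) = a * d - b * c.
Proof.
rewrite (expand_det_row _ 0) !big_ord_recl big_ord0 /cofactor !det_mx11 !mxE /=.
ring.
Qed.

Lemma mxtrace_mx2 a b c d : \tr (mx2 a b c d) = a + d.
Proof. by rewrite /mxtrace big_ord_recl big_ord1 !mxE. Qed.

Lemma invmx_mx2 a b c d :
  a * d - b * c = 1 -> invmx (mx2 a b c d) = mx2 d (- b) (- c) a.
Proof.
move=> det1; have uA : mx2 a b c d \in unitmx.
  by rewrite unitmxE det_mx2 det1 unitr1.
apply: (can_inj (mulKmx uA)); rewrite mulmxV // mx2_mul.
apply/matrixP => -[[|[|//]] hi] -[[|[|//]] hj]; rewrite !mxE /= -?det1; ring.
Qed.

Lemma sqr_mx2 A : \det A = 1 -> A ^+ 2 = \tr A *: A - 1.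
Proof.
rewrite (mx2_eta A) det_mx2 => det1; rewrite expr2 [_ * _]mx2_mul.
rewrite mxtrace_mx2.
apply/matrixP => -[[|[|//]] hi] -[[|[|//]] hj]; rewrite !mxE /= -?det1; ring.
Qed.

Lemma exprSS_mx2 A k : \det A = 1 -> A ^+ k.+2 = \tr A *: A ^+ k.+1 - A ^+ k.
Proof.
move=> /sqr_mx2 A2.
by rewrite !exprS mulrA -expr2 A2 mulrBl mul1r -scalerAl.
Qed.

(** The relation is linear and holds for the identity, whose off-diagonal entries vanish, and for A;
    the Cayley-Hamilton recurrence carries it to all powers. *)
Lemma offdiag_expr A c k :
  \det A = 1 -> A 1 0 = c * A 0 1 -> (A ^+ k) 1 0 = c * (A ^+ k) 0 1.
Proof.
move=> detA Ac.
(* The recurrence has order two, so the induction carries two consecutive exponents. *)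
suff [] : (A ^+ k) 1 0 = c * (A ^+ k) 0 1 /\
          (A ^+ k.+1) 1 0 = c * (A ^+ k.+1) 0 1 by [].
elim: k => [|k [IH0 IH1]]; first by rewrite expr0 expr1 Ac !mxE /= mulr0.
by split=> //; rewrite exprSS_mx2 // !mxE IH0 IH1 mulrBr mulrCA.
Qed.

(** * Riley's equation and its recurrence *)

(* The (1, 2) entry of S W - W T. *)
Definition riley_entry M W := W 1 1 + (M - M^-1) * W 0 1.

Local Notation matT21 M x := (2 - M ^+ 2 - M ^- 2 - x).

(** With f the Riley entry, the hypothesis on W_21 makes the entries of S W - W T, read row by row,
    equal to 0, f, -T_21 f, 0. *)
Lemma riley_criterion M x W :
  M != 0 -> W 1 0 = matT21 M x * W 0 1 ->
  matS M *m W = W *m matT M x <-> riley_entry M W = 0.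
Proof.
move=> M0; rewrite (mx2_eta W) /matS /matT !mx2_mul /riley_entry !mxE /=.
move: (W 0 0) (W 0 1) (W 1 0) (W 1 1) => a b c d ->.
split=> [/matrixP/(_ 0 1)|f0].
  by rewrite !mxE /= => /eqP; rewrite -subr_eq0 => /eqP <-; ring.
have -> : d = - ((M - M^-1) * b) by apply/eqP; rewrite -addr_eq0 f0.
by apply/matrixP => -[[|[|//]] hi] -[[|[|//]] hj]; rewrite !mxE /=; field.
Qed.

(** The factor M^(6k) turns f_(k+2) = tr(A) f_(k+1) - f_k into the recurrence of u. The identity has
    Riley entry 1, so the factor [u 0] accommodates both values of P_0, namely 1 and M^-2. *)
Lemma riley_entry_recurrence M A (u : nat -> K) :
  \det A = 1 -> u 1 = u 0 * (M ^+ 6 * riley_entry M A) ->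
  (forall k, u k.+2 = M ^+ 6 * \tr A * u k.+1 - M ^+ 12 * u k) ->
  forall k, u k = u 0 * (M ^+ (6 * k) * riley_entry M (A ^+ k)).
Proof.
move=> detA u1 urec k.
suff [] : u k = u 0 * (M ^+ (6 * k) * riley_entry M (A ^+ k)) /\
          u k.+1 = u 0 * (M ^+ (6 * k.+1) * riley_entry M (A ^+ k.+1)) by [].
elim: k => [|k [IH0 IH1]].
  by split; rewrite // /riley_entry muln0 !expr0 !mxE /= mulr0 addr0 !mulr1.
split=> //; rewrite urec IH1 IH0 (exprSS_mx2 _ detA) /riley_entry !mxE.
rewrite !mulnS !exprD; ring.
Qed.

(** * The matrix U and the polynomials Q, P_2 and P_-2 *)

Definition matU M x : 'M[K]_2 :=
  let S := matS M in let S' := invmx S in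
  let T := matT M x in let T' := invmx T in
  T *m (S' *m (T *m (S' *m (T' *m (S *m (T' *m S)))))).

Lemma det_matS M : M != 0 -> \det (matS M) = 1.
Proof. by move=> M0; rewrite det_mx2 mulr0 subr0 divff. Qed.

Lemma det_matT M x : M != 0 -> \det (matT M x) = 1.
Proof. by move=> M0; rewrite det_mx2 mul0r subr0 divff. Qed.

Lemma det_matU M x : M != 0 -> \det (matU M x) = 1.
Proof.
by move=> M0; rewrite !det_mulmx !det_inv det_matS ?det_matT // invr1 !mulr1.
Qed.

(** Determinant 1 makes each inverse an adjugate, so the entries become explicit rational
    expressions that [field] can compare. *)
Lemma matUE M x : M != 0 ->
  matU M x =
    let S := matS M in let S' := mx2 M^-1 (- 1) 0 M in
    let T := matT M x in let T' := mx2 M^-1 0 (- matT21 M x) M in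
    T *m (S' *m (T *m (S' *m (T' *m (S *m (T' *m S)))))).
Proof.
move=> M0; rewrite /matU !invmx_mx2 ?oppr0 // -det_mx2.
  exact: det_matT.
exact: det_matS.
Qed.

Lemma matU_offdiag M x : M != 0 -> matU M x 1 0 = matT21 M x * matU M x 0 1.
Proof.
by move=> M0; rewrite matUE // /matS /matT !mx2_mul !mxE /=; field.
Qed.

Local Definition hornerPE :=
  (hornerD, hornerN, hornerZ, hornerX, hornerXn, hornerC).

Lemma polyQE M x : M != 0 -> (polyQ M).[x] = M ^+ 6 * \tr (matU M x).
Proof.
move=> M0; rewrite matUE // /matS /matT !mx2_mul mxtrace_mx2.
by rewrite !hornerPE; field.
Qed.

Lemma polyP2E M x :
  M != 0 -> (polyP2 M).[x] = M ^+ 6 * riley_entry M (matU M x).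
Proof.
move=> M0; rewrite /riley_entry matUE // /matS /matT !mx2_mul.
by rewrite !mxE /= !hornerPE; field.
Qed.

Lemma invmx2E A :
  \det A = 1 -> invmx A = mx2 (A 1 1) (- A 0 1) (- A 1 0) (A 0 0).
Proof. by rewrite {1 2}(mx2_eta A) det_mx2 => /invmx_mx2. Qed.

(** The exponent 4 is 6 - 2: the negative branch starts from P_0 = M^-2. *)
Lemma polyPm2E M x :
  M != 0 -> (polyPm2 M).[x] = M ^+ 4 * riley_entry M (invmx (matU M x)).
Proof.
move=> M0; rewrite invmx2E ?det_matU // /riley_entry !mx2E.
by rewrite matUE // /matS /matT !mx2_mul !mx2E !hornerPE; field.
Qed.

Lemma mxtrace_invmx2 A : \det A = 1 -> \tr (invmx A) = \tr A.
Proof.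
by move=> /invmx2E ->; rewrite [in RHS](mx2_eta A) !mxtrace_mx2 addrC.
Qed.

Definition matW M x (n : int) : 'M[K]_2 :=
  match n with
  | Posz k => matU M x ^+ k
  | Negz k => invmx (matU M x) ^+ k.+1
  end.

Lemma det_invmatU M x : M != 0 -> \det (invmx (matU M x)) = 1.
Proof. by move=> M0; rewrite det_inv det_matU ?invr1. Qed.

Lemma matW_offdiag M x n :
  M != 0 -> matW M x n 1 0 = matT21 M x * matW M x n 0 1.
Proof.
move=> M0; case: n => k; apply: offdiag_expr.
- exact: det_matU.
- exact: matU_offdiag.
- exact: det_invmatU.
(* Inversion negates both off-diagonal entries, so their ratio is kept. *)
- by rewrite invmx2E ?det_matU // !mx2E matU_offdiag // mulrN.
Qed.

(** The value of P_2n at x is the Riley entry of W times P_0 and a power of M, both nonzero. *)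
Lemma root_riley_mednykh M x n :
  M != 0 -> root (riley_mednykh M n) x = (riley_entry M (matW M x n) == 0).
Proof.
move=> M0; rewrite rootE; case: n => k.
  have -> := riley_entry_recurrence (M := M) (A := matU M x)
    (u := fun k => (riley_pos M k).[x]) (det_matU _ M0) _ _ k.
  - by rewrite /= hornerC mul1r mulrI_eq0 //; apply/lregP; rewrite expf_neq0.
  - by rewrite /= polyP2E // hornerC mul1r.
  - by move=> j; rewrite /= -polyQE // hornerD hornerN hornerM hornerZ.
have -> := riley_entry_recurrence (M := M) (A := invmx (matU M x))
  (u := fun k => (riley_neg M k).[x]) (det_invmatU _ M0) _ _ k.+1.
- by rewrite /= hornerC mulrA mulrI_eq0 //; apply/lregP;
    rewrite mulf_neq0 ?invr_neq0 ?expf_neq0.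
- by rewrite [LHS]polyPm2E // /= hornerC; field.
(* U and U^-1 have the same trace, so the same Q drives the negative branch. *)
- move=> j; rewrite mxtrace_invmx2 ?det_matU // -polyQE //.
  by rewrite /= hornerD hornerN hornerM hornerZ.
Qed.

End TwoByTwo.

(** * Representations of the knot group *)

Lemma val_SL_expg m (K : comUnitRingType) (A : SL m.+1 K) k :
  val (A ^+ k)%g = (val A : 'M_m.+1) ^+ k.
Proof. by elim: k => // k IH; rewrite expgS exprS -IH. Qed.

Lemma expi_neq0 (R : realType) (theta : R) : expi theta != 0.
Proof.
apply/eqP => -[c0 s0]; have /eqP := cos2Dsin2 theta.
by rewrite c0 s0 expr0n /= addr0 eq_sym oner_eq0.
Qed.

Theorem theorem7p7 (R : realType) (n : int) (alpha : R) (x : R[i]) :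
  n != 0 ->
  let M : R[i] := expi (alpha / 2) in
  (exists rho : {multiplicative pi1X n -> SL 2 R[i]},
     val (rho (pi1X_s n)) = matS M /\ val (rho (pi1X_t n)) = matT M x)
  <-> root (riley_mednykh M n) x.
Proof.
move=> _ M; have M0 : M != 0 by exact: expi_neq0.
have detS : \det (matS M) == 1 by rewrite det_matS.
have detT : \det (matT M x) == 1 by rewrite det_matT.
pose S : SL 2 R[i] := Sub (matS M) detS.
pose T : SL 2 R[i] := Sub (matT M x) detT.
pose f g := if g is gen_s then S else T.
pose W := weval f (knot_w n).
(* [matU] is nested like [weval] and uses the inverse of [SL], so the two agree by computation. *)
have valW : val W = matW M x n.
  rewrite /W weval_wpow /leval /= mulg1.
  by case: (n) => k; rewrite val_SL_expg.
(* The relation S W T^-1 W^-1 = 1 is rearranged in the group, where equality is equality of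
   matrices. *)
have relE : weval f (knot_relator n) = 1%g <->
    matS M *m val W = val W *m matT M x.
  rewrite /knot_relator !weval_cat weval_winv /= /leval /= !mulg1 -/W.
  rewrite -[matS M]/(val S) -[matT M x]/(val T).
  rewrite !mulgA; split=> [e|e].
    have : (S * W)%g = (W * T)%g.
      apply: (@mulIg _ T^-1%g); rewrite mulgK.
      by apply: (@mulIg _ W^-1%g); rewrite mulgV.
    by move=> /(congr1 val).
  have -> : (S * W)%g = (W * T)%g by apply: val_inj.
  by rewrite mulgK mulgV.
rewrite (root_riley_mednykh _ _ M0) -valW.
rewrite -(rwP eqP) -(@riley_criterion _ M x); last 2 first.
- exact: M0.
- by rewrite valW matW_offdiag.
rewrite -relE; split=> [[rho [rhoS rhoT]]|h].
  apply: (presented_hom_existsP (fun r => r = knot_relator n) f).1 => //.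
  by exists rho => -[]; apply: val_inj.
have [|rho rhoE] := (presented_hom_existsP (fun r => r = knot_relator n) f).2.
  by move=> r ->.
by exists rho; rewrite /pi1X_s /pi1X_t !rhoE.
Qed.
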